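(* Let $a,p,q$ be integers with $a>1$, $p>0$, $1 \le q < p-1$, and let $\{J_n\}_{n=1}^{\infty}$ be the type-2-sequence defined by $J_1 = 1$, $J_2 = a$, $J_n = pJ_{n-1} - qJ_{n-2}$ for $n>2$. Suppose that $\{J_n\}_{n=1}^\infty$ is totally greedy and $a = p-q$. Let $\{J''_k\}_{k=1}^{\infty}$ be the modified subsequence of its even terms, given by $J''_1 = 1$, $J''_2 = a$, and $J''_k = p''J''_{k-1} - q''J''_{k-2} = J_{2k-2}$ for $k>2$, where $p'' = p^2 - 2q$ and $q'' = q^2$. Then $\{J''_k\}_{k=1}^{\infty}$ is also totally greedy.
   Context: Let $S = \{s_1 = 1, s_2, \ldots, s_t\}$ be a set of integers (coin denominations) listed with $1 = s_1 < s_2 < \cdots < s_t$. For an integer $k \ge 0$, a payment vector for $k$ is a vector $(a_1, \ldots, a_t)$ of nonnegative integers with $\sum_{i=1}^t a_i s_i = k$; it is optimal if $\sum_{i=1}^t a_i$ is minimal among all payment vectors for $k$. The greedy payment vector for $k$ is obtained by running, for $i = t, t-1, \ldots, 1$: $a_i := \lfloor k/s_i \rfloor$, then replace $k$ by $k \bmod s_i$. The set $S$ is called greedy if for every integer $k \ge 0$ the greedy payment vector for $k$ is optimal. An integer sequence $\{s_n\}_{n=1}^\infty$ with $s_1 = 1$ and $s_i < s_{i+1}$ for all $i$ is called totally greedy if every prefix subset $\{1, s_2, \ldots, s_k\}$ is greedy. *)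

(* Defs.v *)
From HB Require Import structures.
From mathcomp Require Import all_boot all_order all_algebra.
Set Implicit Arguments.
Unset Strict Implicit.
Unset Printing Implicit Defensive.
Import Order.TTheory GRing.Theory Num.Theory.
Local Open Scope ring_scope.

(* A coin set {s_1 < ... < s_t} is the list [:: s_1; ...; s_t], in increasing
   order; a vector (a_1, ..., a_t) is a list of the same length. *)

Definition payment_vector (S : seq int) (k : int) (v : seq int) : Prop :=
  [/\ size v = size S,
      forall i : nat, (i < size S)%N -> 0 <= v`_i
    & \sum_(i < size S) v`_i * S`_i = k].

Definition optimal_payment (S : seq int) (k : int) (v : seq int) : Prop :=
  payment_vector S k v /\
  forall w : seq int, payment_vector S k w ->
    \sum_(i < size S) v`_i <= \sum_(i < size S) w`_i.

(* [D] lists the denominations from the largest to the smallest, and the result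
   is in the same order. For k >= 0 and s > 0, [(k %/ s)%Z] is the floor. *)
Fixpoint greedy_run (D : seq int) (k : int) : seq int :=
  if D is s :: D' then (k %/ s)%Z :: greedy_run D' (k %% s)%Z else [::].

Definition greedy_payment (S : seq int) (k : int) : seq int :=
  rev (greedy_run (rev S) k).

Definition greedy (S : seq int) : Prop :=
  forall k : int, 0 <= k -> optimal_payment S k (greedy_payment S k).

(* Sequences {s_n}_{n >= 1} are functions on nat whose value at 0 is never
   used. *)

Definition totally_greedy (s : nat -> int) : Prop :=
  [/\ s 1%N = 1,
      forall i : nat, (1 <= i)%N -> s i < s i.+1
    & forall k : nat, (1 <= k)%N -> greedy [seq s i | i <- iota 1 k]].

Definition type2_sequence (a p q : int) (J : nat -> int) : Prop :=
  [/\ J 1%N = 1,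
      J 2%N = a
    & forall n : nat, (2 < n)%N -> J n = p * J (n - 1)%N - q * J (n - 2)%N].

(* Main.v *)
Require Import Defs.
From HB Require Import structures.
From mathcomp Require Import all_boot all_order all_algebra.
From mathcomp Require Import zify ring.
Set Implicit Arguments.
Unset Strict Implicit.
Unset Printing Implicit Defensive.
Import Order.TTheory GRing.Theory Num.Theory.
Local Open Scope ring_scope.

(* The argument is the one-point criterion of Magazine, Nemhauser and Trotter:
   if S is greedy with largest coin c, and s > c is such that m * c - s can be
   paid with at most m - 1 coins of S, then S together with s is greedy. For a
   sequence s_(n+1) = p * s_n - q * s_(n-1) with q < p, one takes m = p, since
   p * s_n - s_(n+1) = q * s_(n-1) is paid with q coins. *)

Definition greedy_size (S : seq int) (k : int) : int :=
  \sum_(i < size S) (greedy_payment S k)`_i.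

Definition payable (S : seq int) (k n : int) : Prop :=
  exists2 v, payment_vector S k v & \sum_(i < size S) v`_i = n.

Lemma size_greedy_payment S k : size (greedy_payment S k) = size S.
Proof.
rewrite /greedy_payment size_rev -(size_rev S).
by elim: (rev S) k => //= s D IH k; rewrite IH.
Qed.

Lemma greedy_payment_rcons S s k :
  greedy_payment (rcons S s) k = rcons (greedy_payment S (k %% s)%Z) (k %/ s)%Z.
Proof. by rewrite /greedy_payment rev_rcons /= rev_cons. Qed.

(** The parameter [F] lets one splitting serve both sums: the first projection counts coins, the
    product gives the amount paid. *)
Lemma big_nth_rcons (S v : seq int) (s c : int) (F : int -> int -> int) :
  size v = size S ->
  \sum_(i < size (rcons S s)) F (rcons v c)`_i (rcons S s)`_i =
  \sum_(i < size S) F v`_i S`_i + F c s.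
Proof.
move=> szv; rewrite size_rcons big_ord_recr /=.
rewrite !nth_rcons szv ltnn eqxx; congr (_ + _).
by apply: eq_bigr => i _; rewrite !nth_rcons szv ltn_ord.
Qed.

Lemma greedy_size_rcons S s k :
  greedy_size (rcons S s) k = (k %/ s)%Z + greedy_size S (k %% s)%Z.
Proof.
rewrite /greedy_size greedy_payment_rcons.
by rewrite (big_nth_rcons _ _ (fun x _ => x)) ?size_greedy_payment // addrC.
Qed.

Lemma payment_vector_rcons S s k v c :
  0 <= c -> payment_vector S k v ->
  payment_vector (rcons S s) (k + c * s) (rcons v c).
Proof.
move=> c_ge0 [szv v_ge0 sumv]; split; first by rewrite !size_rcons szv.
- move=> i; rewrite size_rcons ltnS nth_rcons szv leq_eqVlt.
  case/orP => [/eqP-> | lt_i]; first by rewrite ltnn eqxx.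
  by rewrite lt_i v_ge0.
- by rewrite (big_nth_rcons _ _ (fun x y => x * y)) // sumv.
Qed.

Lemma payableD S k l m n :
  payable S k m -> payable S l n -> payable S (k + l) (m + n).
Proof.
case=> v [szv v_ge0 <-] <- [w [szw w_ge0 <-] <-].
exists (mkseq (fun i => v`_i + w`_i) (size S)); last first.
  by rewrite -big_split; apply: eq_bigr => i _; rewrite nth_mkseq.
split; first by rewrite size_mkseq.
- by move=> i lt_i; rewrite nth_mkseq // addr_ge0 ?v_ge0 ?w_ge0.
- by rewrite -big_split; apply: eq_bigr => i _; rewrite nth_mkseq // mulrDl.
Qed.

Lemma payable_coin (S : seq int) (s n : int) :
  0 <= n -> s \in S -> payable S (n * s) n.
Proof.
move=> n_ge0 /(nthP 0) [i lt_i <-].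
exists (mkseq (fun j => if j == i then n else 0) (size S)); last first.
  rewrite (bigD1 (Ordinal lt_i)) //= nth_mkseq // eqxx big1 ?addr0 // => j.
  by rewrite -val_eqE nth_mkseq //= => /negPf ->.
split; first by rewrite size_mkseq.
- by move=> j lt_j; rewrite nth_mkseq //; case: ifP.
- rewrite (bigD1 (Ordinal lt_i)) //= nth_mkseq // eqxx big1 ?addr0 // => j.
  by rewrite -val_eqE nth_mkseq //= => /negPf ->; rewrite mul0r.
Qed.

Lemma greedy_payable S k :
  greedy S -> 0 <= k -> payable S k (greedy_size S k).
Proof. by move=> grS /grS[pv _]; exists (greedy_payment S k). Qed.

Lemma greedy_size_le S k n :
  greedy S -> 0 <= k -> payable S k n -> greedy_size S k <= n.
Proof. by move=> grS /grS[_ opt] [w /opt + <-]. Qed.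

(** Optimality becomes a local condition: any payment is assembled from 0 one coin at a time, and if
    each added coin raises the greedy count by at most 1, that count never exceeds the number of
    coins in the payment. *)
Lemma greedy_intro (S : seq int) :
  {in S, forall s, 0 < s} ->
  (forall k, 0 <= k -> payment_vector S k (greedy_payment S k)) ->
  greedy_size S 0 = 0 ->
  (forall s k, s \in S -> 0 <= k ->
     greedy_size S (k + s) <= greedy_size S k + 1) ->
  greedy S.
Proof.
move=> S_gt0 S_pay gs0 step k k_ge0; split=> [|w [szw w_ge0 <-]]; first exact: S_pay.
have stepn s l (n : nat) : s \in S -> 0 <= l ->
    greedy_size S (l + n%:Z * s) <= greedy_size S l + n%:Z.
  move=> sS l_ge0; elim: n => [|n IH]; first by rewrite mul0r !addr0.
  have -> : l + n.+1%:Z * s = l + n%:Z * s + s by rewrite intS; ring.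
  apply: le_trans (step _ _ sS _) _; last by rewrite intS; lia.
  by have := S_gt0 _ sS; nia.
pose K n := \sum_(i < n) w`_i * S`_i.
suff main n : (n <= size S)%N ->
    0 <= K n /\ greedy_size S (K n) <= \sum_(i < n) w`_i by have [] := main _ (leqnn _).
elim: n => [|n IH] le_n; first by rewrite /K !big_ord0 gs0.
have [K_ge0 le_K] := IH (ltnW le_n).
have nS : S`_n \in S by rewrite mem_nth.
have := w_ge0 _ le_n; have := S_gt0 _ nS; rewrite /K !big_ord_recr /= -/(K n).
case: (w`_n) => // m s_gt0 _; split; first by nia.
by apply: le_trans (stepn _ _ _ nS K_ge0) _; rewrite lerD2r.
Qed.

(** Adding a coin [x] of [T] to an amount with remainder [y] modulo [s] causes at most one carry,
    since [x <= c < s]. Without a carry, optimality in [T] suffices; with one, the extra coin [s] is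
    allowed because the new remainder takes no more greedy coins than [y]. *)
Lemma greedy_rcons (S : seq int) (c s m n : int) :
  greedy (rcons S c) ->
  {in rcons S c, forall x, 0 < x <= c} -> c < s ->
  0 <= m * c - s -> payable (rcons S c) (m * c - s) n -> n < m ->
  greedy (rcons (rcons S c) s).
Proof.
set T := rcons S c => grT T_le lt_cs d_ge0 pay_d lt_nm.
have cT : c \in T by rewrite mem_rcons mem_head.
have c_gt0 : 0 < c by case/andP: (T_le _ cT).
have s_gt0 : 0 < s by exact: lt_trans lt_cs.
have s_neq0 : s != 0 by rewrite gt_eqF.
(* As [c] is the last coin of [T], [m] more copies of it change only the first greedy quotient. *)
have sizeDM x : greedy_size T (x + m * c) = greedy_size T x + m.
  by rewrite [x + _]addrC !greedy_size_rcons modzMDl divzMDl ?gt_eqF // -addrA addrC.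
apply: greedy_intro.
- move=> x; rewrite mem_rcons inE => /predU1P[-> // | /T_le /andP[]//].
- move=> k k_ge0; rewrite greedy_payment_rcons {1}(divz_eq k s) addrC.
  apply: payment_vector_rcons; first by rewrite divz_ge0.
  by case: (grT (k %% s)%Z); rewrite ?modz_ge0.
(* The empty payment, seen as zero copies of [c], bounds the greedy count at 0 from above. *)
- rewrite greedy_size_rcons div0z mod0z add0r; apply/eqP; rewrite eq_le.
  have pay0 : payable T 0 0 by have := payable_coin (lexx 0) cT; rewrite mul0r.
  rewrite greedy_size_le //=.
  by rewrite sumr_ge0 // => i _; case: (grT 0) => // -[_ ge0 _] _; rewrite ge0.
move=> x k; rewrite mem_rcons inE => /predU1P[-> | xT] k_ge0.
  (* Here the added coin is [s] itself: the quotient grows by 1 and the remainder stays. *)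
  by rewrite [k + s]addrC !(greedy_size_rcons T) -{1 3}[s]mul1r divzMDl // modzMDl; lia.
have /andP[x_gt0 le_xc] := T_le _ xT.
rewrite !(greedy_size_rcons T) {1 2}(divz_eq k s) -addrA divzMDl // modzMDl.
have r_ge0 : 0 <= (k %% s)%Z by rewrite modz_ge0.
have r_lt : (k %% s)%Z < s by rewrite ltz_pmod.
move: (k %/ s)%Z (k %% s)%Z r_ge0 r_lt => b y y_ge0 y_lt.
have pay_y := greedy_payable grT y_ge0.
have pay_x : payable T x 1 by rewrite -[x]mul1r; exact: payable_coin.
have yx_ge0 : 0 <= y + x by lia.
have [lt_yx | le_yx] := ltP (y + x) s.
  rewrite divz_small ?modz_small ?gtr0_norm //; try lia.
  by rewrite addr0 -addrA lerD2l; exact: greedy_size_le (payableD pay_y pay_x).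
pose z := y + x - s.
have -> : y + x = 1 * s + z by rewrite /z; ring.
rewrite divzMDl // modzMDl divz_small ?modz_small ?gtr0_norm //; try lia.
(* Both sides pay [z + m * c = y + x + (m * c - s)]; greedily on the left. *)
have := greedy_size_le grT (addr_ge0 yx_ge0 d_ge0) (payableD (payableD pay_y pay_x) pay_d).
have -> : y + x + (m * c - s) = z + m * c by rewrite /z; ring.
by rewrite sizeDM; lia.
Qed.

Lemma greedy1 : greedy [:: 1].
Proof.
apply: greedy_intro => [x | k k_ge0 | | x k].
- by rewrite inE => /eqP->.
- rewrite /greedy_payment /= divz1; split=> //; first by case.
  by rewrite big_ord1 mulr1.
- by rewrite /greedy_size big_ord1 /greedy_payment /= div0z.
- by rewrite inE => /eqP->; rewrite /greedy_size !big_ord1 /greedy_payment /= !divz1.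
Qed.

(** The difference [J n.+3 - J n.+2] equals [(p - 1 - q) * J n.+2 + q * (J n.+2 - J n.+1)], where by
    induction the first summand is positive and the second nonnegative. *)
Lemma type2_increasing a p q J :
  1 < a -> 0 <= q -> q < p - 1 -> type2_sequence a p q J ->
  forall n, 0 < J n.+1 < J n.+2.
Proof.
move=> a_gt1 q_ge0 lt_qp [J1 J2 Jrec]; elim=> [|n /andP[J_gt0 ltJ]].
  by rewrite J1 J2.
rewrite (Jrec n.+3) // !subSS !subn0; nia.
Qed.

(** Stated for arbitrary parameters so that it applies to [J''], with [p ^+ 2 - 2 * q] and
    [q ^+ 2]. *)
Lemma type2_totally_greedy a p q J :
  1 < a -> 0 <= q -> q < p - 1 -> type2_sequence a p q J -> totally_greedy J.
Proof.
move=> a_gt1 q_ge0 lt_qp HJ; have [J1 J2 Jrec] := HJ.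
have incr := type2_increasing a_gt1 q_ge0 lt_qp HJ.
split=> // [[//|i] _|]; first by case/andP: (incr i).
pose T k := [seq J i | i <- iota 1 k].
have T_S k : T k.+1 = rcons (T k) (J k.+1).
  by rewrite /T -[in LHS](addn1 k) iotaD map_cat cats1.
have T_le k : {in T k, forall x, 0 < x <= J k}.
  elim: k => // k IH x; rewrite T_S mem_rcons inE => /predU1P[-> | /[dup] xT /IH].
    by case/andP: (incr k) => ->; rewrite lexx.
  case: k xT {IH} => // k _ /andP[-> /le_trans->] //.
  by case/andP: (incr k) => _ /ltW.
case=> // k _; rewrite -/(T k.+1); elim: k => [|k IH].
  by rewrite /T /= J1; exact: greedy1.
have /andP[_ ltJ] := incr k.
rewrite T_S; move: IH (T_le k.+1); rewrite T_S => grT leT.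
case: k ltJ grT leT => [|k] ltJ grT leT.
  (* The coin 1 has no predecessor in the sequence, so this prefix uses [m = a]: [a * 1 - a = 0] is
     paid with no coins. *)
  apply: (greedy_rcons (m := a) (n := 0)) => //; rewrite ?J1 ?J2 ?mulr1 ?subrr //.
    by rewrite -(mul0r 1); apply: payable_coin => //; rewrite mem_rcons inE eqxx.
  by lia.
have dE : p * J k.+2 - J k.+3 = q * J k.+1.
  by rewrite (Jrec k.+3) // !subSS !subn0; ring.
apply: (greedy_rcons (m := p) (n := q)) => //; rewrite ?dE; last by lia.
  by case/andP: (incr k) => /ltW ? _; rewrite mulr_ge0.
by apply: payable_coin; rewrite // T_S !mem_rcons !inE !mem_rcons !inE eqxx orbT.
Qed.

(** Eliminating the odd-indexed terms of [J] gives the recurrence of [J'']. The condition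
    [a = p - q] is the recurrence of [J] at index 2 with the value 1 put at index 0, so [J'' 1] also
    acts as an even-indexed term. *)
Lemma type2_even_subsequence a p q J J'' :
  a = p - q -> type2_sequence a p q J ->
  type2_sequence a (p ^+ 2 - 2 * q) (q ^+ 2) J'' ->
  forall k, J'' k.+2 = J k.*2.+2.
Proof.
move=> -> [J1 J2 Jrec] [K1 K2 Krec].
have JS n : J n.+3 = p * J n.+2 - q * J n.+1 by rewrite Jrec // !subSS !subn0.
have KS n : J'' n.+3 = (p ^+ 2 - 2 * q) * J'' n.+2 - q ^+ 2 * J'' n.+1.
  by rewrite Krec // !subSS !subn0.
suff both k : J'' k.+2 = J k.*2.+2 /\ J'' k.+3 = J k.+1.*2.+2.
  by move=> k; case: (both k).
elim: k => [|k [IH1 IH2]].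
  split; first by rewrite K2 J2.
  by rewrite KS K2 K1 (JS 1%N) (JS 0%N) J2 J1; ring.
(* Three instances of the recurrence reduce both sides to [J k.*2.+3] and [J k.*2.+2]. *)
split=> //; rewrite KS IH1 IH2 !doubleS (JS k.*2.+3) (JS k.*2.+2) (JS k.*2.+1).
ring.
Qed.

Theorem corollary6 (a p q : int) (J J'' : nat -> int)
  (ha : 1 < a) (hp : 0 < p) (hq1 : 1 <= q) (hqp : q < p - 1)
  (hJ : type2_sequence a p q J)
  (hJtg : totally_greedy J)
  (hapq : a = p - q)
  (hJ'' : type2_sequence a (p ^+ 2 - 2 * q) (q ^+ 2) J'') :
  (forall k : nat, (2 < k)%N -> J'' k = J (2 * k - 2)%N) /\
  totally_greedy J''.
Proof.
split=> [[|[|k]] // _|].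
  rewrite (type2_even_subsequence hapq hJ hJ''); congr J.
  by rewrite -mul2n; lia.
apply: type2_totally_greedy hJ'' => //; first exact: sqr_ge0.
(* What remains, [q ^+ 2 < p ^+ 2 - 2 * q - 1], is [(q + 1) ^+ 2 < p ^+ 2], which follows from
   [0 < q + 1 < p]. *)
nia.
Qed.
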